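(* Let $\{\mathcal{U}_i\}_{i\in\mathbb{N}}$ be a countable family of either right or left Lebesgue-ultrafilters on $\mathbb{R}$. Let $\{f_i\}_{i\in\mathbb{N}}$ be a family of real valued functions $f_i:\mathbb{R}\to\mathbb{R}$ such that $f_i(0)=0$ for all $i\in\mathbb{N}$ and $$\sum_{i=1}^\infty \sup_{[-m,m]}|f_i|<\infty\quad\text{for all } m>0.$$ Then the functional $\mu:L^\infty(\mathbb{R})\to\mathbb{R}$, $$\mu(u):=\sum_{i=1}^\infty \mathcal{B}\lim_{\mathcal{U}_i}f_i(u),$$ where $f_i(u):=f_i\circ u$, is a translation-invariant valuation. Moreover, if the $f_i$ are monotone non-decreasing (respectively, continuous), then $\mu$ is monotone (respectively, continuous).
   Context: $L^\infty(\mathbb{R})$ is the usual space of essentially bounded Lebesgue measurable functions $\mathbb{R}\to\mathbb{R}$ modulo almost everywhere equality, with the essential supremum norm $\|\cdot\|_\infty$. $\mathbb{N}=\{1,2,\dots\}$. $B_\varepsilon(l)$ is the open interval $(l-\varepsilon,l+\varepsilon)$, and $A^\complement:=\mathbb{R}\setminus A$. A filter on $\mathbb{R}$ is a family $\mathcal{F}$ of subsets of $\mathbb{R}$ with $\mathbb{R}\in\mathcal{F}$, $\emptyset\notin\mathcal{F}$, closed under finite intersections and under supersets in $\mathbb{R}$. An ultrafilter is a filter $\mathcal{U}$ such that for all $A\subseteq\mathbb{R}$ either $A\in\mathcal{U}$ or $A^\complement\in\mathcal{U}$. An ultrafilter $\mathcal{U}$ is a Lebesgue-ultrafilter if $N^\complement\in\mathcal{U}$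 for every Lebesgue-null set $N\subseteq\mathbb{R}$; it is a right (respectively, left) ultrafilter if $(a,\infty)\in\mathcal{U}$ (respectively, $(-\infty,a)\in\mathcal{U}$) for all $a\in\mathbb{R}$. For a Lebesgue-ultrafilter $\mathcal{U}$ and $v\in L^\infty(\mathbb{R})$, $\lim_{\mathcal{U}}v$ is the (unique, representative-independent) real number $l$ such that $\{x\in\mathbb{R}: v(x)\in B_\varepsilon(l)\}\in\mathcal{U}$ for all $\varepsilon>0$. The Cesàro-like average of a bounded measurable $u:\mathbb{R}\to\mathbb{R}$ is $\widehat{u}(0):=u(0)$ and $\widehat{u}(x):=\frac1x\int_0^x u(y)\,dy$ for $x\neq0$ (with $\int_a^b:=-\int_{[b,a]}$ if $b<a$); it induces an operator $\widehat{\cdot}:L^\infty(\mathbb{R})\to L^\infty(\mathbb{R})$. For a right or left Lebesgue-ultrafilter $\mathcal{U}$ and $v\in L^\infty(\mathbb{R})$, $\mathcal{B}\lim_{\mathcal{U}}v:=\lim_{\mathcal{U}}\widehat{v}$. $u\lor v$, $u\land v$ are the pointwise maximum and minimum, $\mathbf{0}$ is the zero function. A valuation is a map $\mu:L^\infty(\mathbb{R})\to\mathbb{R}$ with $\mu(u\lor v)+\mu(u\land v)=\mu(u)+\mu(v)$ for all $u,v\in L^\infty(\mathbb{R})$ and $\mu(\mathbf{0})=0$. It is translation-invariant if $\mu(\mathcal{T}_tu)=\mu(u)$ for all $u\in L^\infty(\mathbb{R})$, $t\in\mathbb{R}$, where $\mathcal{T}_tu(x):=u(x-t)$; monotone if $u\le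 v$ almost everywhere implies $\mu(u)\le\mu(v)$; continuous if $\|u_n-u\|_\infty\to0$ implies $\mu(u_n)\to\mu(u)$.
   Formalization: For the claim that μ is a translation-invariant valuation, the functions f_i∘u are assumed Lebesgue measurable for all i and all u in L^∞(ℝ); for arbitrary f_i the averages of f_i(u) need not be defined. The monotone and continuous claims need no such assumption. *)

(* Defs.v *)
From HB Require Import structures.
From mathcomp Require Import all_boot all_order all_algebra.
From mathcomp Require Import all_classical all_reals all_analysis.
From mathcomp Require Import measurable_realfun ess_sup_inf.

Set Implicit Arguments.
Unset Strict Implicit.
Unset Printing Implicit Defensive.

Import Order.TTheory GRing.Theory Num.Theory.
Import numFieldNormedType.Exports.

Local Open Scope classical_set_scope.
Local Open Scope ring_scope.

(* The real line with the sigma-algebra of Lebesgue (Caratheodory) measurable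
   sets, not only the Borel ones; [leb R] is Lebesgue measure on it. *)
Notation lebR R := (caratheodory_type (wlength (@idfun R))^*%mu).

Definition leb (R : realType) : {measure set (lebR R) -> \bar R} :=
  @completed_lebesgue_measure R.

(* L^oo(R): a.e.-classes of measurable functions with finite essential supremum
   norm. An element coerces to a (chosen) representative [lebR R -> R]. *)
Notation Linf R := (LspaceType (leb R) (leey 1)).

Section Linf_class.
Variable R : realType.
Implicit Types (g : lebR R -> R) (u v : Linf R).

Lemma LinfP u : (u : lebR R -> R) \in Lfun (leb R) +oo%E.
Proof.
apply/andP; split; rewrite inE /=; last first.
  exact: Lebesgue_finite.
move=> mT Y mY.
exact: (@measurable_funPT _ _ _ (measurableTypeR R) (repr (u : {mfun_ (leb R), lebR R >-> measurableTypeR R})%qT) mT Y mY).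
Qed.

Lemma Linf_class_subproof g (gL : g \in Lfun (leb R) +oo%E) :
  @measurable_fun _ _ (lebR R) (measurableTypeR R) setT g.
Proof.
move=> mT Y mY; have /set_mem/= mg := sub_Lfun_mfun gL.
exact: (mg mT Y mY).
Qed.

(* The library's Lspace is built on functions into [measurableTypeR R], which has
   the same measurable sets as [R] but another display, hence this coercion. *)
Definition Linf_mfun g (gL : g \in Lfun (leb R) +oo%E) :
  {mfun lebR R >-> measurableTypeR R} :=
  HB.pack g (@isMeasurableFun.Build _ _ _ (measurableTypeR R) g
    (Linf_class_subproof gL)).

Local Notation ty := {mfun_ (leb R), lebR R >-> measurableTypeR R}.

Definition Linf_pi g (gL : g \in Lfun (leb R) +oo%E) : ty :=
  \pi_ty%qT (Linf_mfun gL).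

Lemma Linf_piE g (gL : g \in Lfun (leb R) +oo%E) :
  \forall x \ae leb R, Linf_pi gL x = g x.
Proof.
have : (repr (Linf_pi gL) = Linf_mfun gL %[mod ty])%qT by rewrite reprK.
by move=> /eqP; rewrite eqmodE => /asboolP; apply: filterS => x /(_ I).
Qed.

Lemma Linf_pi_finite g (gL : g \in Lfun (leb R) +oo%E) :
  finite_norm (leb R) +oo%E (Linf_pi gL).
Proof.
have /set_mem/= := sub_Lfun_finLfun gL.
rewrite /finite_norm unlock/=; case: ifPn => // _; apply: le_lt_trans.
rewrite le_eqVlt; apply/orP; left; apply/eqP; apply: eq_ess_sup.
by apply: filterS (Linf_piE gL) => x /= ->.
Qed.

Definition Linf_class g (gL : g \in Lfun (leb R) +oo%E) : Linf R :=
  LebesgueSpace.Pack (LebesgueSpace.Class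
   (isFinLebesgue.Build _ _ _ _ _ (leey 1) _ (Linf_pi_finite gL))).

Lemma Linf_classE g (gL : g \in Lfun (leb R) +oo%E) :
  \forall x \ae leb R, Linf_class gL x = g x.
Proof. exact: Linf_piE. Qed.

Lemma leb_setT_gt0 : (0 < leb R [set: lebR R])%E.
Proof.
rewrite (@lt_le_trans _ _ (leb R `]0%R, 1%R]%classic))//.
  rewrite [leb R _](_ : _ = (@lebesgue_measure R `]0%R, 1%R]%classic))//.
  by rewrite lebesgue_measure_itv/= lte_fin ltr01 sube0 lte_fin.
apply: (le_outer_measure (wlength (@idfun R))^*%mu) => //.
Qed.

Lemma LfunyP g : g \in Lfun (leb R) +oo%E <->
  measurable_fun setT g /\ exists M : R, \forall x \ae leb R, `|g x| <= M.
Proof.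
have E M : ('N[leb R]_+oo[EFin \o g] <= M%:E)%E <->
    \forall x \ae leb R, `|g x| <= M.
  rewrite unlock/= leb_setT_gt0; split.
    by move/ess_supP; apply: filterS => x /=; rewrite lee_fin.
  by move=> h; apply/ess_supP; apply: filterS h => x /=; rewrite lee_fin.
split=> [/andP[/set_mem/= mg /set_mem/= fg]|[mg [M gM]]].
  split=> //; exists (fine 'N[leb R]_+oo[EFin \o g]); apply/E; rewrite fineK//.
  by rewrite ge0_fin_numE// Lnorm_ge0.
by apply/andP; split; rewrite inE//=; apply: le_lt_trans (ltry M); apply/E.
Qed.

Lemma max_Lfuny g h : g \in Lfun (leb R) +oo%E -> h \in Lfun (leb R) +oo%E ->
  (g \max h) \in Lfun (leb R) +oo%E.
Proof.
move=> /LfunyP[mg [M gM]] /LfunyP[mh [N hN]]; apply/LfunyP; split.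
  exact: measurable_maxr.
exists (Num.max M N); near=> x; rewrite /=.
have gx : `|g x| <= M by near: x.
have hx : `|h x| <= N by near: x.
by rewrite /Num.max; case: ifPn; rewrite le_max ?gx ?hx ?orbT.
Unshelve. all: by end_near. Qed.

Lemma min_Lfuny g h : g \in Lfun (leb R) +oo%E -> h \in Lfun (leb R) +oo%E ->
  (g \min h) \in Lfun (leb R) +oo%E.
Proof.
move=> /LfunyP[mg [M gM]] /LfunyP[mh [N hN]]; apply/LfunyP; split.
  exact: measurable_minr.
exists (Num.max M N); near=> x; rewrite /=.
have gx : `|g x| <= M by near: x.
have hx : `|h x| <= N by near: x.
by rewrite /Num.min; case: ifPn; rewrite le_max ?gx ?hx ?orbT.
Unshelve. all: by end_near. Qed.

Lemma cst_Lfuny (c : R) : cst c \in Lfun (leb R) +oo%E.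
Proof.
apply/LfunyP; split; first exact: measurable_cst.
by exists `|c|; apply: aeW.
Qed.

Local Notation sh t := (fun x : R => x - t : R)%R.
Local Notation out := (wlength (@idfun R))^*%mu.

Lemma out_shift_le (A : set R) (t : R) :
  (out ((sh t) @^-1` A) <= out A)%E.
Proof.
apply: le_ereal_inf_tmp => _ [B [mB AB] <-].
apply: ereal_inf_lbound; exists (fun k => (sh t) @^-1` B k).
- split=> [k|x /AB [k _ Bk]]; last by exists k.
  have [[a b] _ /= <-] := mB k; exists (a + t, b + t) => //=.
  by apply/seteqP; split=> x /=; rewrite !in_itv/= ltrBrDr lerBlDr.
- apply: eq_eseriesr => k _; have [[a b] _ /= <-] := mB k.
  rewrite (_ : _ @^-1` _ = `]a + t, b + t]%classic).
    rewrite !wlength_itv/= !lte_fin ltrD2r; case: ifP => // _.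
    by rewrite -!EFinD; congr EFin; rewrite opprD addrACA subrr addr0.
  by apply/seteqP; split=> x /=; rewrite !in_itv/= ltrBrDr lerBlDr.
Qed.

Lemma out_shift (A : set R) (t : R) :
  out ((sh t) @^-1` A) = out A.
Proof.
apply/eqP; rewrite eq_le out_shift_le/=.
have := out_shift_le ((sh t) @^-1` A) (- t).
by rewrite -comp_preimage (_ : _ \o _ = id)//; apply/funext => x /=; rewrite opprK addrK.
Qed.

Lemma caratheodory_shift (t : R) (A : set R) :
  out.-caratheodory A -> out.-caratheodory (sh t @^-1` A).
Proof.
move=> cA X; have shK (B : set R) : sh (- t) @^-1` (sh t @^-1` B) = B.
  by apply/seteqP; split=> x /=; rewrite opprK addrK.
have E (B : set R) : out (X `&` sh t @^-1` B) = out (sh (- t) @^-1` X `&` B).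
  by rewrite -(out_shift _ (- t)) preimage_setI shK.
have := cA (sh (- t) @^-1` X); rewrite out_shift => ->.
by rewrite -!E preimage_setC.
Qed.

Lemma measurable_shift (t : R) :
  @measurable_fun _ _ (lebR R) (lebR R) setT (sh t).
Proof.
move=> _ A mA; rewrite setTI.
exact: (@caratheodory_shift t A mA).
Qed.

Lemma ae_shift (t : R) (P : R -> Prop) :
  (\forall x \ae leb R, P x) -> \forall x \ae leb R, P (x - t).
Proof.
move=> [N [mN N0 PN]]; exists ((sh t) @^-1` N); split.
- by rewrite -[X in measurable X]setTI; exact: (measurable_shift t).
- by rewrite -[RHS]N0; exact: out_shift.
- by move=> x; exact: PN.
Qed.

Lemma shift_Lfuny g (t : R) : g \in Lfun (leb R) +oo%E ->
  (fun x : R => g (x - t)) \in Lfun (leb R) +oo%E.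
Proof.
move=> /LfunyP[mg [M gM]]; apply/LfunyP; split.
  exact: (measurableT_comp mg (measurable_shift t)).
by exists M; exact: ae_shift gM.
Qed.

Definition Linf0 : Linf R := Linf_class (cst_Lfuny 0).
Definition Linf_max u v : Linf R := Linf_class (max_Lfuny (LinfP u) (LinfP v)).
Definition Linf_min u v : Linf R := Linf_class (min_Lfuny (LinfP u) (LinfP v)).
Definition Linf_translate (t : R) u : Linf R :=
  Linf_class (shift_Lfuny t (LinfP u)).
End Linf_class.

Section ultrafilter_averages.
Variable R : realType.
Implicit Types (U : set_system R) (v : R -> R).

Lemma UltraFilterP U :
  UltraFilter U <-> ProperFilter U /\ forall A, U A \/ U (~` A).
Proof.
split=> [UF|[PF UC]]; first by split=> [|A]; [exact: ultra_proper|
  exact: in_ultra_setVsetC].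
split=> // G GF UG; apply/seteqP; split=> // A GA.
have [//|/UG GCA] := UC A; exfalso.
by apply: (@filter_not_empty _ G); rewrite -(setICr A); exact: filterI.
Qed.

Definition Lebesgue_ultrafilter U :=
  UltraFilter U /\ forall N : set R, (leb R).-negligible N -> U (~` N).

Definition right_ultrafilter U := forall a : R, U `]a, +oo[%classic.

Definition left_ultrafilter U := forall a : R, U `]-oo, a[%classic.

Definition ulim U v : R := lim (v x @[x --> U]).

Definition oriented_integral (a b : R) v : R :=
  if a <= b then \int[leb R]_(y in `[a, b]) v y
  else - \int[leb R]_(y in `[b, a]) v y.

Definition cesaro v (x : R) : R :=
  if x == 0 then v 0 else x^-1 * oriented_integral 0 x v.

Definition Blim U v : R := ulim U (cesaro v).

End ultrafilter_averages.

Section functionals.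
Variable R : realType.
Implicit Types (mu : Linf R -> R) (u v : Linf R).

Definition valuation mu :=
  (forall u v, mu (Linf_max u v) + mu (Linf_min u v) = mu u + mu v) /\
  mu (Linf0 R) = 0.

Definition translation_invariant mu :=
  forall u (t : R), mu (Linf_translate t u) = mu u.

Definition monotone_functional mu :=
  forall u v, (\forall x \ae leb R, u x <= v x) -> mu u <= mu v.

Definition continuous_functional mu :=
  forall (w : nat -> Linf R) u,
    'N[leb R]_+oo[EFin \o (w n \- u)%R]%E @[n --> \oo] --> 0%E ->
    mu (w n) @[n --> \oo] --> mu u.

Definition Blim_sum (U : nat -> set_system R) (f : nat -> R -> R) u : R :=
  limn (series (fun i => Blim (U i) (f i \o u))).

(* [lim] is total, so that the limits and the sum in [Blim_sum] exist, and that
   they do not depend on the representative [g] of [u], is a separate claim. *)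
Definition Blim_sum_well_defined (U : nat -> set_system R)
    (f : nat -> R -> R) :=
  forall u (g : R -> R), (\forall x \ae leb R, g x = u x) ->
    (forall i, cvg (cesaro (f i \o g) x @[x --> U i])) /\
    series (fun i => Blim (U i) (f i \o g)) @ \oo --> Blim_sum U f u.

End functionals.

(* Main.v *)
(* For x != 0, the Cesaro average at x is the mean over the interval between 0
   and x; as an ultrafilter escaping to infinity avoids 0, the Banach limit is
   linear, monotone and bounded by the norm. Averages of bounded v and of its
   translate by t differ by at most 2 |t| M / |x|, hence Banach limits are
   translation invariant. The valuation identity holds termwise because
   f(u \/ v) + f(u /\ v) = f(u) + f(v) pointwise. The series is dominated on
   each ball of L^oo by a summable sequence, so continuity follows by dominated
   convergence from the uniform continuity of each f_i on compact intervals. *)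
Require Import Defs.
From HB Require Import structures.
From mathcomp Require Import all_boot all_order all_algebra.
From mathcomp Require Import all_classical all_reals all_analysis.
From mathcomp Require Import measurable_realfun ess_sup_inf lra.

Set Implicit Arguments.
Unset Strict Implicit.
Unset Printing Implicit Defensive.

Import Order.TTheory GRing.Theory Num.Theory.
Import numFieldNormedType.Exports.

Local Open Scope classical_set_scope.
Local Open Scope ring_scope.

(** * Integrals of essentially bounded functions over sets of finite measure *)

Section Linf_integrals.
Variable R : realType.
Implicit Types (g h : lebR R -> R) (D : set (lebR R)).
Local Notation Loo := (Lfun (leb R) +oo%E).

Lemma measurable_leb_itv (a b : R) : measurable (`[a, b]%classic : set (lebR R)).
Proof.
by apply: sub_caratheodory; exact: measurable_itv.
Qed.

Lemma leb_itv (a b : R) : a <= b -> leb R `[a, b]%classic = (b - a)%:E.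
Proof.
move=> ab; rewrite [LHS](_ : _ = lebesgue_measure (`[a, b]%classic : set R))//.
rewrite lebesgue_measure_itv/= lte_fin; case: ltgtP ab => // -> _.
by rewrite subrr.
Qed.

(** Measurability survives a change on a null set because [leb R] is complete; this is where
    Lebesgue rather than Borel measurability matters. *)
Lemma Lfuny_ae_eq g h : (\forall x \ae leb R, h x = g x) -> g \in Loo ->
  h \in Loo.
Proof.
move=> hg /LfunyP[mg [M gM]]; apply/LfunyP; split; last first.
  by exists M; near=> x; rewrite (_ : h x = g x); near: x.
apply/measurable_EFinP.
apply: (@ae_measurable_fun _ _ _ (leb R) _ _ (EFin \o g)).
- exact: completed_lebesgue_measure_is_complete.
- by near=> x => _ /=; congr EFin; apply/esym; near: x.
- exact/measurable_EFinP.
Unshelve. all: by end_near. Qed.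

Lemma Lfuny_integrable D g : measurable D -> (leb R D < +oo)%E -> g \in Loo ->
  (leb R).-integrable D (EFin \o g).
Proof.
move=> mD Dfin /LfunyP[mg [M gM]].
have mgD : measurable_fun D (EFin \o g).
  by apply/measurable_EFinP; exact: measurable_funTS.
apply/integrableP; split => //.
(* The maximum with 0 makes the majorant nonnegative without deriving the sign of [M]. *)
have M0 : 0 <= Num.max 0 M by rewrite le_max lexx.
apply: (@le_lt_trans _ _ (\int[leb R]_(x in D) (cst (Num.max 0 M)%:E x))%E).
  apply: (@ae_ge0_le_integral _ _ _ (leb R) D mD) => [x _||x _||].
  - exact: abse_ge0.
  - exact: measurableT_comp.
  - by rewrite /= lee_fin.
  - exact: measurable_cst.
  - by near=> x => _ /=; rewrite lee_fin le_max orbC (_ : `|g x| <= M)//; near: x.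
by rewrite integral_cst// lte_mul_pinfty.
Unshelve. all: by end_near. Qed.

Lemma ae_eq_Rintegral D g h : measurable D ->
  g \in Loo -> h \in Loo -> (\forall x \ae leb R, g x = h x) ->
  \int[leb R]_(x in D) g x = \int[leb R]_(x in D) h x.
Proof.
move=> mD /LfunyP[mg _] /LfunyP[mh _] gh; congr fine.
have meas (k : lebR R -> R) : measurable_fun [set: lebR R] k -> measurable_fun D (EFin \o k).
  by move=> mk; apply/measurable_EFinP; exact: measurable_funTS.
apply: (ae_eq_integral (EFin \o h) (EFin \o g) mD (meas g mg) (meas h mh)).
by apply: filterS gh => x /= ghx _; rewrite ghx.
Qed.

(** Replacing [g] by [g \min h] changes it only on a null set and makes the inequality hold
    everywhere. *)
Lemma ae_le_Rintegral D g h : measurable D -> (leb R D < +oo)%E ->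
  g \in Loo -> h \in Loo -> (\forall x \ae leb R, g x <= h x) ->
  \int[leb R]_(x in D) g x <= \int[leb R]_(x in D) h x.
Proof.
move=> mD Dfin gL hL gh.
have ghL : g \min h \in Loo by exact: min_Lfuny.
rewrite (@ae_eq_Rintegral D g (g \min h))//.
  apply: le_Rintegral => //; try exact: Lfuny_integrable.
  by move=> x _; rewrite /= ge_min lexx orbT.
by apply: filterS gh => x /= gh; rewrite min_l.
Qed.

Lemma norm_Rintegral_le D g (M : R) : measurable D -> (leb R D < +oo)%E ->
  g \in Loo -> (\forall x \ae leb R, `|g x| <= M) ->
  `|\int[leb R]_(x in D) g x| <= M * fine (leb R D).
Proof.
move=> mD Dfin gL gM; rewrite -(Rintegral_cst (leb R) mD) ler_norml.
have cL (c : R) : cst c \in Loo by exact: cst_Lfuny.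
apply/andP; split; last first.
  apply: ae_le_Rintegral => //; first exact: cL.
  by apply: filterS gM => x; rewrite ler_norml => /andP[].
have -> : - (\int[leb R]_(_ in D) M) = \int[leb R]_(_ in D) (- M).
  by rewrite !Rintegral_cst// mulNr.
apply: ae_le_Rintegral => //; first exact: cL.
by apply: filterS gM => x; rewrite ler_norml => /andP[].
Qed.

(** The contributions of the intersection cancel, leaving only the two set differences. *)
Lemma norm_RintegralB_le A B g (M : R) :
  measurable A -> measurable B -> (leb R A < +oo)%E -> (leb R B < +oo)%E ->
  g \in Loo -> (\forall x \ae leb R, `|g x| <= M) ->
  `|\int[leb R]_(x in A) g x - \int[leb R]_(x in B) g x| <=
  M * (fine (leb R (A `\` B)) + fine (leb R (B `\` A))).
Proof.
move=> mA mB Afin Bfin gL gM.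
have split X Y : measurable X -> measurable Y -> (leb R X < +oo)%E ->
    \int[leb R]_(x in X) g x =
    \int[leb R]_(x in X `&` Y) g x + \int[leb R]_(x in X `\` Y) g x.
  move=> mX mY Xfin; rewrite -Rintegral_setU ?setUIDK//.
  - exact: measurableI.
  - exact: measurableD.
  - exact: Lfuny_integrable.
  - by apply/disj_setPS => x [[_ +] [_]].
have Dfin X Y : measurable X -> measurable Y -> (leb R X < +oo)%E ->
    (leb R (X `\` Y) < +oo)%E.
  move=> mX mY; apply: le_lt_trans; apply: le_measure; rewrite ?inE//.
  exact: measurableD.
rewrite (split A B)// (split B A)// (setIC B) opprD addrACA subrr add0r.
rewrite mulrDr (le_trans (ler_normB _ _))// lerD// norm_Rintegral_le//;
  by [exact: measurableD | exact: Dfin].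
Qed.

(** Change of variables: by [out_shift], the pushforward of Lebesgue measure under a translation is
    Lebesgue measure. *)
Lemma Rintegral_shift D g (t : R) : measurable D -> (leb R D < +oo)%E ->
  g \in Loo ->
  \int[leb R]_(x in (fun x : R => x - t) @^-1` D) g (x - t) =
  \int[leb R]_(x in D) g x.
Proof.
move=> mD Dfin gL; congr fine.
pose s : lebR R -> lebR R := fun x : R => x - t.
have ms : measurable_fun setT s by exact: measurable_shift.
have mDs : measurable (s @^-1` D).
  by rewrite -[X in measurable X]setTI; exact: ms.
have shiftE X : leb R (s @^-1` X) = leb R X by exact: out_shift.
have mg : measurable_fun [set: lebR R] (EFin \o g).
  by apply/measurable_EFinP; case/LfunyP : gL.
have gsL : (leb R).-integrable (s @^-1` D) ((EFin \o g) \o s).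
  apply: (Lfuny_integrable (g := fun x : R => g (x - t))) => //.
    by rewrite shiftE.
  exact: shift_Lfuny.
transitivity (\int[pushforward (leb R) s]_(x in D) (g x)%:E)%E.
  exact/esym/(integral_pushforward ms mg gsL mD).
by apply: eq_measure_integral => A mA AD; exact: shiftE.
Qed.

End Linf_integrals.

(** * Cesaro averages and Banach limits along ultrafilters *)

Section averages.
Variable R : realType.
Implicit Types (g h : lebR R -> R) (U : set_system R).
(* Unqualified, [cesaro] is a theorem of MathComp-Analysis. *)
Local Notation cesaro := Defs.cesaro.
Local Notation Loo := (Lfun (leb R) +oo%E).

Lemma leb_itv_fin (a b : R) : (leb R `[a, b]%classic < +oo)%E.
Proof.
have [ab|ba] := leP a b; first by rewrite leb_itv// ltry.
by rewrite set_itv_ge ?measure0// bnd_simp -ltNge.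
Qed.

(** The part of an interval missed by its translate lies at one end: in [[a, a + c]] if [c] is
    nonnegative, in [[b + c, b]] otherwise. *)
Lemma leb_itvD_le (a b c : R) :
  fine (leb R (`[a, b] `\` `[a + c, b + c])%classic) <= `|c|.
Proof.
pose I : set (lebR R) := (`[a, b] `\` `[a + c, b + c])%classic.
pose J : set (lebR R) := if 0 <= c then `[a, a + c]%classic else `[b + c, b]%classic.
have mI : measurable I.
  by apply: measurableD; exact: measurable_leb_itv.
have mJ : measurable J by rewrite /J; case: ifP => _; exact: measurable_leb_itv.
have IJ : I `<=` J.
  move=> x [xab xabc]; have /andP[ax xb] : a <= x <= b by exact: xab.
  have /negP : ~ (a + c <= x <= b + c) by exact: xabc.
  rewrite negb_and -!ltNge /J; case: (leP 0 c) => c0 /orP[] xc.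
  - by apply/andP; split=> //; exact: ltW.
  - by exfalso; lra.
  - by exfalso; lra.
  - by apply/andP; split=> //; exact: ltW.
have JE : leb R J = `|c|%:E.
  rewrite /J; case: (leP 0 c) => c0.
    rewrite leb_itv; last by lra.
    by rewrite ger0_norm// addrC addKr.
  rewrite leb_itv; last by lra.
  by rewrite ltr0_norm// opprD addrA subrr sub0r.
have IJc : (leb R I <= `|c|%:E)%E.
  by rewrite -JE; apply: le_measure IJ; rewrite inE.
by rewrite -lee_fin fineK// ge0_fin_numE// (le_lt_trans IJc)// ltry.
Qed.

Let hull (x : R) : set (lebR R) := `[Num.min 0 x, Num.max 0 x]%classic.

Let measurable_hull x : measurable (hull x).
Proof. exact: measurable_leb_itv. Qed.

Let leb_hull_fin x : (leb R (hull x) < +oo)%E.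
Proof. exact: leb_itv_fin. Qed.

Let leb_hull x : fine (leb R (hull x)) = `|x|.
Proof.
rewrite /hull; case: leP => x0; rewrite leb_itv ?(ltW x0)//=.
  by rewrite subr0 ger0_norm.
by rewrite sub0r ltr0_norm.
Qed.

(** For negative [x], the sign of the oriented integral cancels that of [x^-1], so both half-lines
    share one formula. *)
Let cesaroE g (x : R) : x != 0 ->
  cesaro g x = `|x|^-1 * \int[leb R]_(y in hull x) g y.
Proof.
move=> x0; rewrite /cesaro (negbTE x0) /oriented_integral /hull.
case: leP => [x_ge0|x_lt0]; first by rewrite ger0_norm.
by rewrite ltr0_norm// invrN mulrN mulNr.
Qed.

Lemma cesaro_ae_le g h (x : R) : x != 0 -> g \in Loo -> h \in Loo ->
  (\forall y \ae leb R, g y <= h y) -> cesaro g x <= cesaro h x.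
Proof.
move=> x0 gL hL gh; rewrite !cesaroE// ler_wpM2l ?invr_ge0//.
exact: ae_le_Rintegral.
Qed.

Lemma cesaroD g h (x : R) : x != 0 -> g \in Loo -> h \in Loo ->
  cesaro (g \+ h) x = cesaro g x + cesaro h x.
Proof.
move=> x0 gL hL; rewrite !cesaroE// -mulrDr; congr (_ * _).
by apply: RintegralD => //; exact: Lfuny_integrable.
Qed.

Lemma cesaro_cst (c x : R) : x != 0 -> cesaro (cst c) x = c.
Proof.
move=> x0; rewrite cesaroE// Rintegral_cst// leb_hull mulrCA mulVf ?mulr1//.
by rewrite normr_eq0.
Qed.

(** Averaging the translate amounts to averaging [g] over the hull moved by [- t]; each of the two
    set differences has length at most [|t|]. *)
Lemma cesaro_shift g (t M x : R) : x != 0 -> g \in Loo ->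
  (\forall y \ae leb R, `|g y| <= M) ->
  `|cesaro (fun y => g (y - t)) x - cesaro g x| <= `|x|^-1 * (M * (2 * `|t|)).
Proof.
move=> x0 gL gM; rewrite !cesaroE// -mulrBr normrM ger0_norm ?invr_ge0//.
rewrite ler_wpM2l ?invr_ge0//.
set a := Num.min 0 x; set b := Num.max 0 x.
(* The bound on the integral over the hull, whose length [|x|] is positive, forces [M] to be
   nonnegative. *)
have M0 : 0 <= M.
  have /LfunyP[mg _] := gL.
  have : `|\int[leb R]_(x in hull x) g x| <= M * `|x|.
    by rewrite -leb_hull norm_Rintegral_le.
  by move/(le_trans (normr_ge0 _)); rewrite pmulr_lge0// normr_gt0.
pose J : set (lebR R) := `[a - t, b - t]%classic.
(* Both hulls become preimages of [J]; after the change of variables in the first integral, the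
   second one is turned back into [hull x]. *)
have -> : hull x = (fun y : R => y - t) @^-1` J.
  by apply/seteqP; split=> y; rewrite /hull /J /= !in_itv/= !lerD2r.
have mJ : measurable J by exact: measurable_leb_itv.
rewrite (@Rintegral_shift _ J)//; last exact: leb_itv_fin.
rewrite (_ : _ @^-1` _ = hull x); last first.
  by apply/seteqP; split=> y; rewrite /hull /J /= !in_itv/= !lerD2r.
rewrite (le_trans (norm_RintegralB_le _ _ _ _ gL gM))//; first exact: leb_itv_fin.
rewrite ler_wpM2l// mulr_natl mulr2n lerD//.
  have := leb_itvD_le (a - t) (b - t) t; rewrite !subrK; exact.
by have := leb_itvD_le a b (- t); rewrite normrN; exact.
Qed.

(* All that is used of right and left ultrafilters. *)
Definition escaping U := UltraFilter U /\ forall a : R, U [set x | a < `|x|].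

Lemma escaping_right_left U : UltraFilter U ->
  right_ultrafilter U \/ left_ultrafilter U -> escaping U.
Proof.
move=> UU UE; split => // a; case: UE => UE.
  apply: filterS (UE a) => x /=; rewrite in_itv/= andbT => ax.
  by rewrite (lt_le_trans ax)// ler_norm.
apply: filterS (UE (- a)) => x /=; rewrite in_itv/= ltrNr => ax.
by rewrite (lt_le_trans ax)// -normrN ler_norm.
Qed.

Lemma escaping_neq0 U : escaping U -> \forall x \near U, x != 0.
Proof.
by move=> [UU UE]; apply: filterS (UE 0) => x /=; rewrite normr_gt0.
Qed.

(** The image of an ultrafilter is an ultrafilter; as it contains a compact segment, it
    converges. *)
Lemma ultrafilter_bounded_cvg U (v : R -> R) (a b : R) : UltraFilter U ->
  (\forall x \near U, a <= v x <= b) -> cvg (v x @[x --> U]).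
Proof.
move=> UU vab; have := @segment_compact R a b; rewrite compact_ultra.
have vab' : (v x @[x --> U]) `[a, b]%classic.
  by apply: filterS vab => x /=; rewrite in_itv.
have vUU : UltraFilter (v x @[x --> U]).
  have [PU UC] := (UltraFilterP U).1 UU.
  by apply/UltraFilterP; split=> [|A]; [exact: fmap_proper_filter|exact: UC].
move=> /(_ _ vUU vab')[l [_ vl]].
by apply/cvg_ex; exists l.
Qed.

Lemma cvg_cesaro U g : escaping U -> g \in Loo -> cvg (cesaro g x @[x --> U]).
Proof.
move=> UE gL; have /LfunyP[mg [M gM]] := gL; have [UU _] := UE.
apply: (@ultrafilter_bounded_cvg U _ (- M) M UU).
apply: filterS (escaping_neq0 UE) => x x0.
(* Constants are their own averages, so monotonicity confines the average of [g] between [- M] and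
   [M]. *)
have cM := cesaro_cst M x0; have cNM := cesaro_cst (- M) x0.
rewrite -{1}cNM -{2}cM; apply/andP; split; apply: cesaro_ae_le => //;
  rewrite ?cst_Lfuny//;
by apply: filterS gM => y /=; rewrite ler_norml => /andP[].
Qed.

Lemma Blim_ae_le U g h : escaping U -> g \in Loo -> h \in Loo ->
  (\forall y \ae leb R, g y <= h y) -> Blim U g <= Blim U h.
Proof.
move=> UE gL hL gh; have [UU _] := UE; have PU := @ultra_proper _ _ UU.
apply: ler_lim; [exact: cvg_cesaro|exact: cvg_cesaro|].
by apply: filterS (escaping_neq0 UE) => x x0; exact: cesaro_ae_le.
Qed.

Lemma Blim_ae_eq U g h : escaping U -> g \in Loo -> h \in Loo ->
  (\forall y \ae leb R, g y = h y) -> Blim U g = Blim U h.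
Proof.
move=> UE gL hL gh; apply/eqP; rewrite eq_le !Blim_ae_le//;
by apply: filterS gh => y ->.
Qed.

Lemma BlimD U g h : escaping U -> g \in Loo -> h \in Loo ->
  Blim U (g \+ h) = Blim U g + Blim U h.
Proof.
move=> UE gL hL; have [UU _] := UE; have PU := @ultra_proper _ _ UU.
apply: cvg_lim => //.
apply: (@cvg_trans _ ((cesaro g x + cesaro h x) @[x --> U])).
  apply: near_eq_cvg; apply: filterS (escaping_neq0 UE) => x x0.
  by rewrite cesaroD.
by apply: cvgD; exact: cvg_cesaro.
Qed.

Lemma Blim_cst U (c : R) : escaping U -> Blim U (cst c) = c.
Proof.
move=> UE; have [UU _] := UE; have PU := @ultra_proper _ _ UU.
apply: cvg_lim => //.
apply: (@cvg_trans _ (c @[x --> U])); last exact: cvg_cst.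
apply: near_eq_cvg; apply: filterS (escaping_neq0 UE) => x x0.
by rewrite cesaro_cst.
Qed.

(** Monotonicity and additivity are applied to [g <= h + e] and [h <= g + e], which avoids
    differences altogether. *)
Lemma norm_BlimB_le U g h (e : R) : escaping U -> g \in Loo -> h \in Loo ->
  (\forall y \ae leb R, `|g y - h y| <= e) -> `|Blim U g - Blim U h| <= e.
Proof.
move=> UE gL hL ghe.
have eL : cst e \in Loo by exact: cst_Lfuny.
have DL k : k \in Loo -> k \+ cst e \in Loo.
  by move=> kL; exact: (Lfun_addr_closed _ (leey 1)).2.
rewrite ler_distl lerBlDr -(Blim_cst e UE) -!BlimD//.
apply/andP; split; apply: Blim_ae_le; rewrite ?DL//;
by apply: filterS ghe => y /=; rewrite ler_distl lerBlDr => /andP[].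
Qed.

Lemma norm_Blim_le U g (M : R) : escaping U -> g \in Loo ->
  (\forall y \ae leb R, `|g y| <= M) -> `|Blim U g| <= M.
Proof.
move=> UE gL gM; rewrite -[Blim U g]subr0 -(Blim_cst 0 UE) norm_BlimB_le//.
  exact: cst_Lfuny.
by apply: filterS gM => y /=; rewrite subr0.
Qed.

Lemma Blim_shift U g (t : R) : escaping U -> g \in Loo ->
  Blim U (fun x => g (x - t)) = Blim U g.
Proof.
move=> UE gL; have [UU Ua] := UE; have PU := @ultra_proper _ _ UU.
have /LfunyP[_ [M gM]] := gL.
apply: cvg_lim => //.
rewrite -[Blim U g]addr0.
(* The average of the translate is that of [g] plus a difference, which is shown to tend to 0. *)
apply: (@cvg_trans _ ((cesaro g x + (cesaro (fun y => g (y - t)) x - cesaro g x))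
    @[x --> U])).
  by apply: near_eq_cvg; apply: nearW => x; rewrite addrC subrK.
apply: cvgD; first exact: cvg_cesaro.
apply/cvgr0Pnorm_le => e e0.
(* Beyond this threshold for [|x|], the bound of [cesaro_shift] is at most [e]. *)
apply: filterS (filterI (escaping_neq0 UE) (Ua (M * (2 * `|t|) / e))) => x [x0 Mx].
rewrite (le_trans (cesaro_shift t x0 gL gM))//.
rewrite ler_pdivrMl ?normr_gt0// mulrC -ler_pdivrMr//.
by rewrite mulrC ltW// mulrC.
Qed.

End averages.

(** * Dominated series and uniform continuity on segments *)

Section dominated_series.
Variable R : realType.
Implicit Types (a s : nat -> R).

Lemma dominated_is_cvg_series a s : (forall i, `|a i| <= s i) ->
  cvgn (series s) -> cvgn (series a).
Proof.
move=> as_ cs; apply: normed_cvg; apply: series_le_cvg cs => //= i.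
exact: le_trans (as_ i).
Qed.

(** The inequality holds between partial sums and passes to the limit. The bound depends on [s]
    alone, hence is uniform over all dominated series. *)
Lemma dominated_series_tail_le a s (N : nat) : (forall i, `|a i| <= s i) ->
  cvgn (series s) ->
  `|limn (series a) - series a N| <= limn (series s) - series s N.
Proof.
move=> as_ cs; have ca := dominated_is_cvg_series as_ cs.
have s_ge0 i : 0 <= s i by exact: le_trans (as_ i).
have near_le : \forall m \near \oo,
    `|series a m - series a N| <= limn (series s) - series s N.
  near=> m; have Nm : (N <= m)%N by near: m; exact: nbhs_infty_ge.
  rewrite sub_series_geq// (le_trans (ler_norm_sum _ _ _))//.
  rewrite (@le_trans _ _ (series s m - series s N))//.
    by rewrite sub_series_geq// ler_sum.
  rewrite lerB// nondecreasing_cvgn_le//.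
  by apply: nondecreasing_series => i _ _; exact: s_ge0.
rewrite ler_distl; apply/andP; split; [apply: limr_ge => //|apply: limr_le => //];
  by apply: filterS near_le => m; rewrite ler_distl => /andP[].
Unshelve. all: by end_near. Qed.

(** Tannery's theorem: the tails are uniformly small and the remaining finite sum converges
    termwise. *)
Lemma dominated_series_cvg (a : nat -> nat -> R) (b s : nat -> R) :
  (\forall n \near \oo, forall i, `|a n i| <= s i) -> cvgn (series s) ->
  (forall i, a n i @[n --> \oo] --> b i) ->
  limn (series (a n)) @[n --> \oo] --> limn (series b).
Proof.
move=> as_ cs ab.
(* The termwise limit inherits the domination, so the tail estimate applies to it too. *)
have bs i : `|b i| <= s i.
  rewrite -(cvg_lim _ (cvg_norm (ab i)))//.
  apply: limr_le; first by apply: is_cvg_norm; apply/cvg_ex; exists (b i).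
  by apply: filterS as_ => n; exact.
apply/cvgrPdist_le => e e0.
(* One third for each of the two tails, one for the difference of the heads. *)
have e3 : 0 < e / 3 by rewrite divr_gt0.
have /cvgrPdist_le/(_ _ e3)[N _ sN] := cs.
have {}sN : limn (series s) - series s N <= e / 3.
  by rewrite (le_trans (ler_norm _))//; exact: (sN N (leqnn N)).
have sumN : series (a n) N @[n --> \oo] --> series b N.
  by apply: cvg_big => [|i _]; [exact: add_continuous|exact: ab].
have /cvgrPdist_le/(_ _ e3) near_sum := sumN.
near=> n.
have an : forall i, `|a n i| <= s i by near: n.
have abN : `|series b N - series (a n) N| <= e / 3 by near: n.
have := dominated_series_tail_le N an cs.
have := dominated_series_tail_le N bs cs.
move: abN sN; rewrite !ler_norml => *; lra.
Unshelve. all: by end_near. Qed.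

Lemma summable_majorant (f : nat -> R -> R) (m : R) :
  (\sum_(0 <= i <oo)
    ereal_sup [set (`|f i x|)%:E | x in `[(- m)%R, m]%classic] < +oo)%E ->
  0 <= m ->
  exists2 s : nat -> R, cvgn (series s) &
    forall i x, `|x| <= m -> `|f i x| <= s i.
Proof.
move=> fsum m0.
set S := fun i => ereal_sup [set (`|f i x|)%:E | x in `[(- m)%R, m]%classic].
have fS i x : `|x| <= m -> (`|f i x|%:E <= S i)%E.
  move=> xm; apply: ereal_sup_ubound; exists x => //=.
  by rewrite in_itv/= -ler_norml.
(* The point 0 lies in the segment as [m] is nonnegative; the supremum of an empty set would be
   [-oo]. *)
have S0 i : (0 <= S i)%E by apply: le_trans (fS i 0 _); rewrite ?normr0.
have Sfin i : S i \is a fin_num.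
  rewrite ge0_fin_numE// (le_lt_trans _ fsum)//.
  (* A term is at most the partial sum with [i.+1] terms, which includes it, hence at most the
     finite total. *)
  apply: le_trans (nneseries_lim_ge (u_ := S) (P := xpredT) i.+1 _) => //.
  by rewrite big_nat_recr//= leeDr// sume_ge0.
exists (fine \o S) => [|i x xm]; last first.
  by rewrite -lee_fin fineK// fS.
apply: nnseries_is_cvg => [i|]; first exact: fine_ge0.
by apply: le_lt_trans fsum; apply: lee_nneseries => i *; rewrite /= ?lee_fin ?fine_ge0 ?fineK.
Qed.

(** A form of Heine-Cantor in which only [x] is confined to the segment. Compactness is used as
    near-covering, with [d] tending to 0 from the right. *)
Lemma continuous_segment_uniform (f : R -> R) (m e : R) : continuous f -> 0 < e ->
  exists2 d, 0 < d & forall x y, `|x| <= m -> `|x - y| < d -> `|f x - f y| < e.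
Proof.
move=> cf e0.
have /compact_near_coveringP/(_ _ (0^'+)
  (fun d x => forall y, `|x - y| < d -> `|f x - f y| < e)) := @segment_compact R (- m) m.
case.
  move=> x _.
  have e2 : 0 < e / 2 by rewrite divr_gt0.
  have /cvgrPdist_lt/(_ _ e2)/nbhs_ballP[r /= r0 fr] := cf x.
  have r2 : 0 < r / 2 by rewrite divr_gt0.
  (* With [x'] within [r / 2] of [x] and [y] within [r / 2] of [x'], both are within [r] of [x]. *)
  exists (ball x (r / 2), [set d | d < r / 2]).
    by split; [exact: nbhsx_ballx|exact: nbhs_right_lt].
  move=> [x' d] [/= xx' dr] y x'y.
  have fx' : `|f x - f x'| < e / 2.
    apply: fr; rewrite /ball/=; apply: lt_trans xx' _; lra.
  have fy : `|f x - f y| < e / 2.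
    apply: fr; move: xx' x'y; rewrite /ball/= !ltr_norml => *; lra.
  by move: fx' fy; rewrite !ltr_norml => *; lra.
move=> d0 /= d0_gt0 Hd; exists (d0 / 2); first by rewrite divr_gt0.
move=> x y xm xy; apply: (Hd (d0 / 2)) => //=.
- rewrite sub0r normrN gtr0_norm ?divr_gt0//; lra.
- by rewrite divr_gt0.
- by rewrite in_itv/= -ler_norml.
Qed.

End dominated_series.

(** * Almost everywhere bounds *)

Section Linf_bounds.
Variable R : realType.
Local Notation Loo := (Lfun (leb R) +oo%E).

(** The nonnegative bound serves as a radius [m] for the summable majorants. *)
Lemma Lfuny_bound (g : lebR R -> R) : g \in Loo ->
  exists2 M : R, 0 <= M & \forall x \ae leb R, `|g x| <= M.
Proof.
move=> /LfunyP[_ [M gM]]; exists (Num.max 0 M); first by rewrite le_max lexx.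
by apply: filterS gM => x gM; rewrite le_max gM orbT.
Qed.

Lemma ae_Lnormy_le (g : lebR R -> R) (e : R) :
  ('N[leb R]_+oo[EFin \o g] <= e%:E)%E -> \forall x \ae leb R, `|g x| <= e.
Proof.
by rewrite unlock/= leb_setT_gt0 => /ess_supP; apply: filterS => x /=;
  rewrite lee_fin.
Qed.

End Linf_bounds.

(** * The functional [Blim_sum] and its properties *)

Section Blim_sums.
Variables (R : realType) (U : nat -> set_system R) (f : nat -> R -> R).
Local Notation Loo := (Lfun (leb R) +oo%E).
Hypothesis UE : forall i, escaping (U i).
Hypothesis f0 : forall i, f i 0 = 0.
Hypothesis fsum : forall m : R, 0 <= m ->
  exists2 s : nat -> R, cvgn (series s) &
    forall i x, `|x| <= m -> `|f i x| <= s i.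
Hypothesis mf : forall i (u : Linf R), measurable_fun [set: lebR R] (f i \o u).

(** The hypothesis [mf] concerns chosen representatives only, so [g] is first replaced by that of
    its class; the majorant gives boundedness. *)
Lemma comp_Lfuny (g : lebR R -> R) i : g \in Loo -> f i \o g \in Loo.
Proof.
move=> gL; apply: (@Lfuny_ae_eq _ (f i \o Linf_class gL)).
  by apply: filterS (Linf_classE gL) => x /= ->.
apply/LfunyP; split=> //.
have [M M0 gM] := Lfuny_bound (LinfP (Linf_class gL)).
have [s _ fs] := fsum M0; exists (s i).
by apply: filterS gM => x; exact: fs.
Qed.

Lemma Blim_comp_le (g : lebR R -> R) (s : nat -> R) (m : R) : g \in Loo ->
  (forall i x, `|x| <= m -> `|f i x| <= s i) ->
  (\forall x \ae leb R, `|g x| <= m) ->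
  forall i, `|Blim (U i) (f i \o g)| <= s i.
Proof.
move=> gL fs gm i; apply: norm_Blim_le => //; first exact: comp_Lfuny.
by apply: filterS gm => x; exact: fs.
Qed.

Lemma cvg_Blim_series (g : lebR R -> R) : g \in Loo ->
  cvgn (series (fun i => Blim (U i) (f i \o g))).
Proof.
move=> gL; have [M M0 gM] := Lfuny_bound gL; have [s cs fs] := fsum M0.
exact: dominated_is_cvg_series (Blim_comp_le gL fs gM) cs.
Qed.

Lemma Blim_comp_ae_eq (g h : lebR R -> R) i : g \in Loo ->
  (\forall x \ae leb R, h x = g x) ->
  Blim (U i) (f i \o h) = Blim (U i) (f i \o g).
Proof.
move=> gL hg; apply: Blim_ae_eq => //; try apply: comp_Lfuny => //.
  exact: Lfuny_ae_eq hg gL.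
by apply: filterS hg => x /= ->.
Qed.

(** Maximum, minimum, translation and zero in [Linf R] are all built by [Linf_class]; this reduces
    their values to explicit functions. *)
Lemma Blim_sum_class (g : lebR R -> R) (gL : g \in Loo) :
  Blim_sum U f (Linf_class gL) = limn (series (fun i => Blim (U i) (f i \o g))).
Proof.
congr (limn (series _)); apply/funext => i.
by apply: Blim_comp_ae_eq => //; exact: Linf_classE.
Qed.

Lemma Blim_sum_has_limits : Blim_sum_well_defined U f.
Proof.
move=> u g gu; have gL := Lfuny_ae_eq gu (LinfP u); split=> [i|].
  by apply: cvg_cesaro => //; exact: comp_Lfuny.
have -> : (fun i => Blim (U i) (f i \o g)) = (fun i => Blim (U i) (f i \o u)).
  by apply/funext => i; apply: Blim_comp_ae_eq => //; exact: LinfP.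
exact: cvg_Blim_series (LinfP u).
Qed.

Lemma Blim_series_modular (g h : lebR R -> R) : g \in Loo -> h \in Loo ->
  let S k := limn (series (fun i => Blim (U i) (f i \o k))) in
  S (g \max h) + S (g \min h) = S g + S h.
Proof.
move=> gL hL S; have [maxL minL] := (max_Lfuny gL hL, min_Lfuny gL hL).
have cvgS k l : k \in Loo -> l \in Loo ->
    series (fun i => Blim (U i) (f i \o k)) n +
    series (fun i => Blim (U i) (f i \o l)) n @[n --> \oo] --> S k + S l.
  by move=> kL lL; apply: cvgD; exact: cvg_Blim_series.
(* The partial sums of the two sides agree for every [n], so their limits coincide. *)
apply: (cvg_unique _ (cvgS _ _ maxL minL)) => //.
apply: cvg_trans (cvgS _ _ gL hL); apply: near_eq_cvg; apply: nearW => n.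
rewrite /series/= -!big_split/=; apply: eq_bigr => i _.
rewrite -!BlimD; [|exact: UE|exact: comp_Lfuny|exact: comp_Lfuny
  |exact: UE|exact: comp_Lfuny|exact: comp_Lfuny].
congr (Blim (U i) _); apply/funext => x /=.
by rewrite /Num.max /Num.min; case: ifPn => // _; rewrite addrC.
Qed.

Lemma Blim_sum_valuation : valuation (Blim_sum U f).
Proof.
split=> [u v|].
  rewrite !Blim_sum_class; exact: Blim_series_modular (LinfP u) (LinfP v).
rewrite Blim_sum_class; apply: cvg_lim => //.
have -> : series (fun i => Blim (U i) (f i \o cst 0)) = cst 0; last exact: cvg_cst.
apply/funext => n; apply: big1 => i _.
rewrite (_ : f i \o cst 0 = cst 0) ?Blim_cst//.
by apply/funext => x /=; rewrite f0.
Qed.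

Lemma Blim_sum_translation_invariant : translation_invariant (Blim_sum U f).
Proof.
move=> u t; rewrite Blim_sum_class; congr (limn (series _)); apply/funext => i.
by rewrite -[RHS](Blim_shift t)//; exact: comp_Lfuny (LinfP u).
Qed.

Lemma Blim_sum_monotone : (forall i, {homo f i : x y / x <= y}) ->
  monotone_functional (Blim_sum U f).
Proof.
move=> fh u v uv.
apply: ler_lim; [exact: cvg_Blim_series (LinfP u)|exact: cvg_Blim_series (LinfP v)|].
apply: nearW => n; apply: ler_sum => i _.
apply: Blim_ae_le => //; try exact: comp_Lfuny (LinfP _).
by apply: filterS uv => x; exact: fh.
Qed.

Lemma Blim_sum_continuous : (forall i, continuous (f i)) ->
  continuous_functional (Blim_sum U f).
Proof.
move=> fc w u wu; have [M M0 uM] := Lfuny_bound (LinfP u).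
(* Eventually [w n] is within 1 of [u], so one majorant, for radius [M + 1], serves [u] and all
   these [w n]. *)
have M1 : 0 <= M + 1 by rewrite addr_ge0.
have near_wu e : 0 < e -> \forall n \near \oo, \forall x \ae leb R, `|w n x - u x| <= e.
  move=> e0; have /fine_cvgP[wfin /cvgr0Pnorm_le/(_ _ e0) we] := wu.
  near=> n; apply: ae_Lnormy_le.
  have wn : 'N[leb R]_+oo[EFin \o (w n \- u)%R]%E \is a fin_num by near: n.
  rewrite -(fineK wn) lee_fin (le_trans (ler_norm _))//.
  by near: n.
have [s cs fs] := fsum M1.
apply: (dominated_series_cvg (s := s)) => // [|i].
  apply: filterS (near_wu 1 ltr01) => n wn.
  apply: Blim_comp_le fs _; first exact: LinfP.
  near=> x.
  have ux : `|u x| <= M by near: x.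
  have wx : `|w n x - u x| <= 1 by near: x.
  by rewrite -(subrK (u x) (w n x)) addrC (le_trans (ler_normD _ _))// lerD.
apply/cvgrPdist_le => e e0.
(* Only [u] stays in [[- M, M]]; [w n] may leave it. Halving [d] turns the non-strict bound of
   [near_wu] into the strict one required. *)
have [d d0 fd] := continuous_segment_uniform M (fc i) e0.
have d2 : 0 < d / 2 by rewrite divr_gt0.
apply: filterS (near_wu _ d2) => n wn.
apply: norm_BlimB_le => //; try exact: comp_Lfuny (LinfP _).
near=> x; apply: ltW; apply: fd; first by near: x.
rewrite distrC (@le_lt_trans _ _ (d / 2))//; last by lra.
by near: x.
Unshelve. all: by end_near. Qed.

End Blim_sums.

(** Measurability of [f i \o u] is what makes it a member of L^oo. It is a premise of the first
    claim; in the other two it follows from monotonicity or continuity, which make [f i] Borel. *)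
Theorem proposition8p4 (R : realType)
    (U : nat -> set_system R) (f : nat -> R -> R)
    (hU : forall i, Lebesgue_ultrafilter (U i))
    (hUrl : forall i, right_ultrafilter (U i) \/ left_ultrafilter (U i))
    (f0 : forall i, f i 0 = 0)
    (fsum : forall m : R, 0 < m ->
      (\sum_(0 <= i <oo)
         ereal_sup [set (`|f i x|)%:E | x in `[(- m)%R, m]%classic] < +oo)%E) :
  ((forall i (u : Linf R), measurable_fun [set: lebR R] (f i \o u)) ->
     [/\ Blim_sum_well_defined U f,
         valuation (Blim_sum U f) &
         translation_invariant (Blim_sum U f)]) /\
  ((forall i, {homo f i : x y / x <= y}) ->
     monotone_functional (Blim_sum U f)) /\
  ((forall i, continuous (f i)) ->
     continuous_functional (Blim_sum U f)).
Proof.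
have UE i : escaping (U i) by apply: escaping_right_left; [exact: (hU i).1|].
have fs (m : R) : 0 <= m -> exists2 s : nat -> R, cvgn (series s) &
    forall i x, `|x| <= m -> `|f i x| <= s i.
  (* The summability hypothesis concerns positive radii; enlarging [m] to [m + 1] covers radius
     0. *)
  move=> m0; have m1 : 0 < m + 1 by rewrite ltr_wpDl.
  have [s cs fs] := summable_majorant (fsum _ m1) (ltW m1); exists s => // i x xm.
  by rewrite fs// (le_trans xm)// lerDl.
have mf_of : (forall i, @measurable_fun _ _ R R setT (f i)) ->
    forall i (u : Linf R), measurable_fun [set: lebR R] (f i \o u).
  move=> mf i u; have /LfunyP[mu _] := LinfP u.
  exact: (measurableT_comp (mf i) mu).
split=> [mf|].
  split; [exact: Blim_sum_has_limits|exact: Blim_sum_valuation|].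
  exact: Blim_sum_translation_invariant.
split=> [fh|fc].
  apply: (Blim_sum_monotone UE fs _ fh); apply: mf_of => i.
  exact: nondecreasing_measurable measurableT (fh i).
apply: (Blim_sum_continuous UE fs _ fc); apply: mf_of => i.
exact: continuous_measurable_fun (fc i).
Qed.
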